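(* Let $a,b \in \mathbb{R}$ with $a<b$. If $f \colon [a,b] \to \mathbb{R}$ is a continuous function with $f(a)=f(b)$, then there exists $c$ in the open interval $]a,b[$ such that $\{0\}\times\mathbb{R} \subseteq \Lambda_c(f)$.
   Context: $\Bbbk$ is any fixed nonzero commutative ring of finite global dimension. Microsupport: for a (smooth) manifold $P$ and $F$ in the bounded derived category $\mathrm{D}^{\mathrm b}(\Bbbk_P)$ of sheaves of $\Bbbk$-modules, $\mathrm{Ppg}(F)$ is the set of $(p,\xi) \in T^*P$ such that for every open neighborhood $U$ of $p$ and every $\phi \in C^\infty(U)$ with $\phi(p)=0$ and $d\phi(p)=\xi$ one has $(\mathrm{R}\Gamma_{\{\phi \geq 0\}}(F))_p = 0$; the microsupport is $\mu\mathrm{supp}(F) = \overline{T^*P \setminus \mathrm{Ppg}(F)}$. For a locally closed $A \subseteq P$, $\mu\mathrm{supp}(A)$ denotes the microsupport of the constant sheaf on $A$ with stalk $\Bbbk$ extended by zero to $P$. For $c \in \,]a,b[$, $\Lambda_c(f) \subseteq \mathbb{R}\times\mathbb{R}$ denotes the fiber over $(c,f(c))$ of $\mu\mathrm{supp}(\Gamma)$, where $\Gamma \subseteq \,]a,b[\,\times\mathbb{R}$ is the graph of the restriction of $f$ to $]a,b[$; the first factor of $\mathbb{R}\times\mathbb{R}$ is the cotangent space of the domain and the second that of the codomain. *)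

(* Defs.v *)
From HB Require Import structures.
From mathcomp Require Import all_boot all_order all_algebra.
From mathcomp Require Import all_classical all_reals all_analysis.

Set Implicit Arguments.
Unset Strict Implicit.
Unset Printing Implicit Defensive.

Import Order.TTheory GRing.Theory Num.Theory.
Import numFieldNormedType.Exports.

Local Open Scope classical_set_scope.
Local Open Scope ring_scope.

Section GlobalDimension.
Variable k : comNzRingType.

Definition projective_module (Q : lmodType k) : Prop :=
  forall (M N : lmodType k) (e : {linear M -> N}) (g : {linear Q -> N}),
    (forall y, exists x, e x = y) ->
    exists h : {linear Q -> M}, forall x, e (h x) = g x.

Definition proj_dim_le (n : nat) (M : lmodType k) : Prop :=
  exists (Q : nat -> lmodType k) (d : forall i, {linear Q i.+1 -> Q i})
         (e : {linear Q 0 -> M}),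
    [/\ forall i, projective_module (Q i),
        forall i (x : Q i), (n < i)%N -> x = 0,
        forall y, exists x, e x = y,
        forall x, e x = 0 <-> exists y, d 0 y = x
      & forall i (x : Q i.+1), d i x = 0 <-> exists y, d i.+1 y = x].

Definition finite_global_dimension : Prop :=
  exists n, forall M : lmodType k, proj_dim_le n M.

End GlobalDimension.

Record opens (T : topologicalType) (P : set T) := Opens {
  carrier :> set T;
  opens_open : open carrier;
  opens_sub : carrier `<=` P }.

(* For P open in T, this is a sheaf of k-modules on the space P. *)
Record sheaf (k : comNzRingType) (T : topologicalType) (P : set T) := Sheaf {
  sections :> opens P -> lmodType k;
  res : forall U V : opens P, V `<=` U -> {linear sections U -> sections V};
  res_id : forall (U : opens P) (h : U `<=` U) s, res h s = s;
  res_comp : forall (U V W : opens P) (hUV : V `<=` U) (hVW : W `<=` V)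
      (hUW : W `<=` U) s, res hVW (res hUV s) = res hUW s;
  sheaf_sep : forall (U : opens P) (I : Type) (V : I -> opens P)
      (hV : forall i, V i `<=` U), U `<=` \bigcup_i V i ->
      forall s t : sections U, (forall i, res (hV i) s = res (hV i) t) -> s = t;
  sheaf_glue : forall (U : opens P) (I : Type) (V : I -> opens P)
      (hV : forall i, V i `<=` U), U `<=` \bigcup_i V i ->
      forall s : (forall i, sections (V i)),
      (forall i j (W : opens P) (hi : W `<=` V i) (hj : W `<=` V j),
         res hi (s i) = res hj (s j)) ->
      exists t : sections U, forall i, res (hV i) t = s i }.

Arguments res {k T P s U V} h : rename.

Section SheafTheory.
Variables (k : comNzRingType) (T : topologicalType) (P : set T).
Implicit Types F G I : sheaf k P.

Record sheaf_hom F G := SheafHom {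
  hom_fun :> forall U : opens P, {linear F U -> G U};
  hom_res : forall (U V : opens P) (h : V `<=` U) (s : F U),
      hom_fun V (res h s) = res h (hom_fun U s) }.

Definition injective_sheaf I : Prop :=
  forall F G (i : sheaf_hom F G) (g : sheaf_hom F I),
    (forall U, injective (i U)) ->
    exists h : sheaf_hom G I, forall U s, h U (i U s) = g U s.

Record cochain := Cochain {
  cochain_term :> int -> sheaf k P;
  diffl : forall i, sheaf_hom (cochain_term i) (cochain_term (i + 1));
  diffl2 : forall i U (s : cochain_term i U), diffl (i + 1) U (diffl i U s) = 0 }.

Definition bounded_below (C : cochain) : Prop :=
  exists m, forall i, i < m -> forall U (s : C i U), s = 0.

Definition bounded_above (C : cochain) : Prop :=
  exists m, forall i, m < i -> forall U (s : C i U), s = 0.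

(* These represent all the objects of the bounded derived category. *)
Record bounded_cochain := BoundedCochain {
  bcx :> cochain;
  bcx_below : bounded_below bcx;
  bcx_above : bounded_above bcx }.

Record cochain_hom (C D : cochain) := CochainHom {
  chom :> forall i, sheaf_hom (C i) (D i);
  chom_diffl : forall i U (s : C i U),
      chom (i + 1) U (diffl C i U s) = diffl D i U (chom i U s) }.

(* The map induced on the cohomology sheaves is injective, resp. surjective,
   on stalks; as i ranges over all integers, i + 1 is an arbitrary degree. *)
Definition quasi_iso (C D : cochain) (q : cochain_hom C D) : Prop :=
  (forall i (U : opens P) (s : C (i + 1) U) (t : D i U),
     diffl C (i + 1) U s = 0 -> q (i + 1) U s = diffl D i U t ->
     forall x, carrier U x -> exists (V : opens P) (h : V `<=` U) (u : C i V),
       carrier V x /\ diffl C i V u = res h s) /\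
  (forall i (U : opens P) (t : D (i + 1) U),
     diffl D (i + 1) U t = 0 ->
     forall x, carrier U x -> exists (V : opens P) (h : V `<=` U)
         (s : C (i + 1) V) (u : D i V),
       [/\ carrier V x, diffl C (i + 1) V s = 0
         & res h t = q (i + 1) V s + diffl D i V u]).

Definition injective_resolution (C I : cochain) (q : cochain_hom C I) : Prop :=
  [/\ bounded_below I, forall i, injective_sheaf (I i) & quasi_iso q].

Definition supported_in F (Z : set T) (V : opens P) (s : F V) : Prop :=
  forall (W : opens P) (h : W `<=` V), W `&` Z = set0 -> res h s = 0.

(* (R Gamma_Z (C|_U))_p = 0 for Z closed in the open neighborhood U of p.
   R Gamma_Z is computed by an injective resolution I (all of them give the same
   answer; the restriction of I to U is again injective), and the condition is
   the exactness of the complex of stalks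
   colim_(p \in V `<=` U) Gamma_Z(V, I), the colimit being written out. *)
Definition RGamma_stalk_eq0 (C : bounded_cochain) (U : opens P) (Z : set T) (p : T) :
    Prop :=
  exists (I : cochain) (q : cochain_hom C I), injective_resolution q /\
  forall i (V : opens P) (s : I (i + 1) V), V `<=` U -> carrier V p ->
    supported_in Z s -> diffl I (i + 1) V s = 0 ->
    exists (W : opens P) (h : W `<=` V) (t : I i W),
      [/\ carrier W p, supported_in Z t & diffl I i W t = res h s].

End SheafTheory.

Section ConstantSheaf.
Variables (k : comNzRingType) (T : topologicalType) (P : set T).

(* Sections over U of the constant sheaf with stalk k on the locally closed
   subset A, extended by zero to P: the locally constant functions on A `&` U
   whose support is closed in U. They are encoded as functions on T vanishing
   outside of A `&` U. *)
Definition cst_sec_prop (A : set T) (U : opens P) (s : T -> k) : Prop :=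
  [/\ forall x, ~ (A `&` U) x -> s x = 0,
      forall x, (A `&` U) x -> \forall y \near x, A y -> s y = s x
    & U `&` closure [set x | s x != 0] `<=` [set x | s x != 0]].

Definition cst_sec_pred (A : set T) (U : opens P) : {pred (T -> k^o)} :=
  fun s => `[< cst_sec_prop A U s >].

Lemma cst_sec_near0 (A : set T) (U : opens P) (s : T -> k) x :
  cst_sec_prop A U s -> carrier U x -> s x = 0 -> \forall y \near x, s y = 0.
Proof.
move=> [_ _ h] Ux sx; apply: contrapT => nx.
have /h /= : (U `&` closure [set x | s x != 0]) x.
  split=> // B Bx; apply: contrapT => /= nB; apply: nx.
  apply: filterS Bx => y By; apply: contrapT => /eqP sy.
  by apply: nB; exists y.
by rewrite sx eqxx.
Qed.

Lemma cst_sec_submod (A : set T) (U : opens P) :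
  GRing.subsemimod_closed (cst_sec_pred A U).
Proof.
suff H c s t : cst_sec_prop A U s -> cst_sec_prop A U t ->
    cst_sec_prop A U (fun x => c * s x + t x).
  have H0 : cst_sec_prop A U (fun=> 0).
    split=> [//|x _|x [_ cl]]; first exact: nearW.
    by have [y []] := cl setT filterT; rewrite /= eqxx.
  split; first split.
  - exact/asboolP.
  - move=> s t /asboolP hs /asboolP ht; apply/asboolP.
    rewrite (_ : s + t = fun x => 1 * s x + t x); first exact: H.
    by apply/funext => x; rewrite mul1r.
  - move=> c s /asboolP hs; apply/asboolP.
    rewrite (_ : c *: s = fun x => c * s x + 0); first exact: H.
    by apply/funext => x; rewrite addr0.
move=> hs ht; have [s1 s2 s3] := hs; have [t1 t2 t3] := ht; split.
- by move=> x Ax; rewrite s1// t1// mulr0 addr0.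
- move=> x Ax; have sx := s2 x Ax; have tx := t2 x Ax.
  by apply: filterS2 sx tx => y sy ty Ay; rewrite sy// ty.
- move=> x [Ux cl]; apply/eqP => e0.
  suff /cl [y [/= /eqP + yE]] : \forall y \near x, c * s y + t y = 0 by [].
  have [Ax|Ax] := pselect (A x); last first.
    have := cst_sec_near0 hs Ux (s1 x (fun h => Ax h.1)).
    have := cst_sec_near0 ht Ux (t1 x (fun h => Ax h.1)).
    by apply: filterS2 => y ty sy; rewrite sy ty mulr0 addr0.
  have sx := s2 x (conj Ax Ux); have tx := t2 x (conj Ax Ux).
  apply: filterS2 sx tx => y sy ty; have [Ay|Ay] := pselect (A y).
    by rewrite sy// ty.
  by rewrite s1 ?t1 ?mulr0 ?addr0 => // -[].
Qed.

HB.instance Definition _ A U :=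
  GRing.isSubmodClosed.Build k (T -> k^o) (cst_sec_pred A U)
    (cst_sec_submod A U).

Record cst_sec (A : set T) (U : opens P) := CstSec {
  cst_sec_val : T -> k^o;
  cst_sec_valP : cst_sec_val \in cst_sec_pred A U }.

HB.instance Definition _ A U := [isSub for @cst_sec_val A U].
HB.instance Definition _ A U := [Choice of cst_sec A U by <:].
HB.instance Definition _ A U :=
  [SubChoice_isSubLmodule of cst_sec A U by <:].


Implicit Types (A : set T) (U V W : opens P).

Definition cst_res_fun V (s : T -> k^o) : T -> k^o :=
  fun x => if x \in (V : set T) then s x else 0.

Lemma cst_res_subproof A U V (h : V `<=` U) (s : cst_sec A U) :
  cst_res_fun V (\val s) \in cst_sec_pred A V.
Proof.
have /asboolP[s1 s2 s3] := valP s; apply/asboolP.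
have nV x : carrier V x -> \forall y \near x, carrier V y.
  by move=> Vx; apply: open_nbhs_nbhs; split=> //; exact: opens_open.
split=> [x nx|x [Ax Vx]|x [Vx cl]]; rewrite /cst_res_fun /=.
- by case: ifPn => // /set_mem Vx; apply: s1 => -[Ax _]; exact: nx.
- have := s2 x (conj Ax (h _ Vx)); have := nV x Vx.
  by apply: filterS2 => y Vy sy Ay; rewrite !mem_set//; exact: sy.
- rewrite mem_set//; apply: s3; split; first exact: h.
  move=> B /cl [y [/= + By]]; rewrite /cst_res_fun; case: ifP => [_ sy|].
    by exists y.
  by rewrite eqxx.
Qed.

Definition cst_res A U V (h : V `<=` U) (s : cst_sec A U) : cst_sec A V :=
  CstSec (cst_res_subproof h s).

Lemma cst_res_linear A U V (h : V `<=` U) : linear (@cst_res A U V h).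
Proof.
move=> c s t; apply/val_inj/funext => x; rewrite /= /cst_res_fun !fctE.
by case: ifP => // _; rewrite scaler0 addr0.
Qed.

HB.instance Definition _ A U V (h : V `<=` U) :=
  GRing.isLinear.Build k (cst_sec A U) (cst_sec A V) *:%R (@cst_res A U V h)
    (@cst_res_linear A U V h).

Lemma cst_res_id A U (h : U `<=` U) (s : cst_sec A U) : cst_res h s = s.
Proof.
apply/val_inj/funext => x /=; rewrite /cst_res_fun; case: ifPn => // nU.
have /asboolP[s1 _ _] := valP s.
by rewrite s1// => -[_ Ux]; rewrite mem_set in nU.
Qed.

Lemma cst_res_comp A U V W (hUV : V `<=` U) (hVW : W `<=` V) (hUW : W `<=` U)
  (s : cst_sec A U) : cst_res hVW (cst_res hUV s) = cst_res hUW s.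
Proof.
apply/val_inj/funext => x /=; rewrite /cst_res_fun; case: ifPn => // /set_mem Wx.
by rewrite mem_set//; exact: hVW.
Qed.

Lemma cst_sep A U (I : Type) (V : I -> opens P) (hV : forall i, V i `<=` U) :
  U `<=` \bigcup_i V i -> forall s t : cst_sec A U,
  (forall i, cst_res (hV i) s = cst_res (hV i) t) -> s = t.
Proof.
move=> cov s t st; apply/val_inj/funext => x /=.
have /asboolP[s1 _ _] := valP s; have /asboolP[t1 _ _] := valP t.
have [Ux|nU] := pselect (carrier U x); last first.
  by rewrite s1 ?t1// => -[].
have [i _ Vx] := cov x Ux.
by have /(congr1 (fun u => \val u x)) := st i; rewrite /= /cst_res_fun mem_set.
Qed.

Lemma cst_glue A U (I : Type) (V : I -> opens P) (hV : forall i, V i `<=` U) :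
  U `<=` \bigcup_i V i -> forall s : (forall i, cst_sec A (V i)),
  (forall i j W (hi : W `<=` V i) (hj : W `<=` V j),
     cst_res hi (s i) = cst_res hj (s j)) ->
  exists t : cst_sec A U, forall i, cst_res (hV i) t = s i.
Proof.
move=> cov s agree.
pose t x : k^o := if pselect (exists i, carrier (V i) x) is left e
  then \val (s (projT1 (cid e))) x else 0.
have tE i x : carrier (V i) x -> t x = \val (s i) x.
  move=> Vx; rewrite /t; case: pselect => [e|[]]; last by exists i.
  case: cid => j /= Vjx.
  have oW : open (V i `&` V j) by apply: openI; exact: opens_open.
  have sW : V i `&` V j `<=` P by move=> y [Viy _]; exact: opens_sub Viy.
  have := agree i j (Opens oW sW) (@subIsetl _ _ _) (@subIsetr _ _ _).
  by move=> /(congr1 (fun u => \val u x)); rewrite /= /cst_res_fun mem_set.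
have tN x : ~ carrier U x -> t x = 0.
  by move=> nU; rewrite /t; case: pselect => // -[i Vx]; case: nU; exact: hV Vx.
have nV i x : carrier (V i) x -> \forall y \near x, carrier (V i) y.
  by move=> Vx; apply: open_nbhs_nbhs; split=> //; exact: opens_open.
have tP : t \in cst_sec_pred A U.
  apply/asboolP; split=> [x nx|x [Ax Ux]|x [Ux cl]].
  - have [Ux|] := pselect (carrier U x); last exact: tN.
    have [i _ Vx] := cov x Ux; rewrite (tE i)//.
    by have /asboolP[s1 _ _] := valP (s i); apply: s1 => -[Ax _]; exact: nx.
  - have [i _ Vx] := cov x Ux; have /asboolP[_ s2 _] := valP (s i).
    have := s2 x (conj Ax Vx); have := nV i x Vx.
    by apply: filterS2 => y Vy sy Ay; rewrite !(tE i)//; exact: sy.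
  - have [i _ Vx] := cov x Ux; apply/eqP => tx.
    have /asboolP sP := valP (s i).
    have sx : \val (s i) x = 0 by rewrite -tE.
    suff /cl [y [/= /eqP + yE]] : \forall y \near x, t y = 0 by [].
    have := nV i x Vx; have := cst_sec_near0 sP Vx sx.
    by apply: filterS2 => y sy Vy; rewrite (tE i).
exists (CstSec tP) => i; apply/val_inj/funext => x /=; rewrite /cst_res_fun.
case: ifPn => [/set_mem|nV']; first exact: tE.
have /asboolP[s1 _ _] := valP (s i).
by rewrite s1// => -[_ Vx]; rewrite mem_set in nV'.
Qed.

Definition cst_sheaf A : sheaf k P :=
  @Sheaf k T P (cst_sec A) (fun U V h => @cst_res A U V h)
    (@cst_res_id A) (@cst_res_comp A) (@cst_sep A) (@cst_glue A).

End ConstantSheaf.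

Section Concentrated.
Variables (k : comNzRingType) (T : topologicalType) (P : set T).

Definition zero_sheaf : sheaf k P := cst_sheaf k P set0.

Lemma zero_sheafE U (s : zero_sheaf U) : s = 0.
Proof.
apply/val_inj/funext => x /=; have /asboolP[s1 _ _] := valP s.
by rewrite s1// => -[].
Qed.

Lemma zero_hom_res (F G : sheaf k P) (U V : opens P) (h : V `<=` U) (s : F U) :
  (\0 : {linear F V -> G V}) (res h s) = res h ((\0 : {linear F U -> G U}) s).
Proof. by rewrite /= raddf0. Qed.

Definition zero_hom (F G : sheaf k P) : sheaf_hom F G :=
  SheafHom (@zero_hom_res F G).

Variable F : sheaf k P.

Definition concentrated_term (i : int) : sheaf k P :=
  if i == 0 then F else zero_sheaf.

Definition concentrated_cochain : cochain k P :=
  @Cochain _ _ _ concentrated_term (fun i => zero_hom _ _)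
    (fun i U s => erefl).

Lemma concentrated_below : bounded_below concentrated_cochain.
Proof.
exists 0 => i i0 U.
have -> : cochain_term concentrated_cochain i = zero_sheaf.
  by rewrite /= /concentrated_term lt_eqF.
exact: zero_sheafE.
Qed.

Lemma concentrated_above : bounded_above concentrated_cochain.
Proof.
exists 0 => i i0 U.
have -> : cochain_term concentrated_cochain i = zero_sheaf.
  by rewrite /= /concentrated_term gt_eqF.
exact: zero_sheafE.
Qed.

(* the sheaf F placed in degree 0 *)
Definition concentrated : bounded_cochain k P :=
  BoundedCochain concentrated_below concentrated_above.

End Concentrated.

Section Microsupport.
Variables (R : realType) (k : comNzRingType).
Local Notation plane := (R * R)%type.

Definition iter_derive (vs : seq plane) (phi : plane -> R) : plane -> R :=
  foldr (fun v g => 'D_v g) phi vs.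

(* phi is C^oo on the open set U: all its iterated directional derivatives are
   differentiable, hence continuous, on U. Only the values of phi on U matter. *)
Definition smooth_on (U : set plane) (phi : plane -> R) : Prop :=
  forall vs x, U x -> differentiable (iter_derive vs phi) x.

(* The manifold is an open subset P of the plane; its cotangent bundle is
   P `*` plane, a covector xi being identified with v |-> xi.1 v.1 + xi.2 v.2. *)
Variable P : set plane.

Definition Ppg (F : bounded_cochain k P) : set (plane * plane) :=
  fun '(p, xi) => P p /\
    forall (U : opens P) (phi : plane -> R),
      carrier U p -> smooth_on U phi -> phi p = 0 ->
      (forall v : plane, 'd phi p v = xi.1 * v.1 + xi.2 * v.2) ->
      RGamma_stalk_eq0 F U (carrier U `&` [set x | 0 <= phi x]) p.

(* The closure is taken in the cotangent bundle of P. *)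
Definition musupp (F : bounded_cochain k P) : set (plane * plane) :=
  (P `*` setT) `&` closure ((P `*` setT) `\` Ppg F).

Definition musupp_set (A : set plane) : set (plane * plane) :=
  musupp (concentrated (cst_sheaf k P A)).

End Microsupport.

Definition strip (R : realType) (a b : R) : set (R * R) := `]a, b[ `*` setT.

Definition open_graph (R : realType) (a b : R) (f : R -> R) : set (R * R) :=
  [set z | (a < z.1 < b) /\ z.2 = f z.1].

Definition Lambda (R : realType) (k : comNzRingType) (a b : R) (f : R -> R)
    (c : R) : set (R * R) :=
  [set xi | musupp_set k (strip a b) (open_graph a b f) ((c, f c), xi)].

(* Main.v *)
From HB Require Import structures.
Require Import Defs.
From mathcomp Require Import all_boot all_order all_algebra.
From mathcomp Require Import all_classical all_reals all_analysis.
From mathcomp Require Import ring lra.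

Import Order.TTheory GRing.Theory Num.Theory.
Import numFieldNormedType.Exports.

Local Open Scope classical_set_scope.
Local Open Scope ring_scope.

(** Since [f a = f b], the function [f] has a maximum or a minimum at some
    interior point [c], and every vertical covector [(0, tau)] at
    [p = (c, f c)] is then outside of the propagation set of the constant
    sheaf [F] on the graph. The sign of [tau * (f x - f c)] does not depend on
    [x], and there are two cases.

    If [tau * (f x - f c) >= 0], the linear test function
    [phi = tau * (y - f c)] is nonnegative on the graph, so the sections of [F]
    supported in [{phi >= 0}] are all its sections, and the degree 0 stalk at
    [p] is [k], which is nonzero ([RGamma_stalk_neq0_deg0]).

    If [tau * (f x - f c) <= 0], the test function
    [phi = tau * (y - f c) - (x - c)^2] has the same differential at [p], but
    [{phi >= 0}] now meets the graph in [p] only. The local cohomology at a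
    point of a line does not vanish in degree 1: the section that is 1 to the
    right of [p] and 0 to its left is not the restriction of a section defined
    around [p] ([RGamma_stalk_neq0_cut]).

    Local cohomology is computed by an arbitrary injective resolution [I] of
    [F], so the degree 1 class has to be produced inside [I]. Let [A] be the
    graph and [B] its part strictly to the right of [p]. Injectivity is used
    once, to extend the composite [k_B -> k_A -> I^0] along the monomorphism
    [k_B -> k_(B + p)]: the image [s] in [I^0] of the section 1 of [k_(B + p)]
    agrees away from [p] with the section 1 of [k_B], so that [d s] is a
    cocycle supported at [p]. Writing it as [d t] with [t] supported in
    [{phi >= 0}] would make [s - t] a cocycle, that is, locally a section of
    [k_A] up to a coboundary, equal to 1 on one side of [p] and 0 on the
    other. *)

(** * Maps and sections of constant sheaves *)

Section ConstantSheafMaps.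
Context {k : comNzRingType} {T : topologicalType} {P : set T}.
Implicit Types (A B : set T) (U V W : opens P).

(** A section of [k_A] extended by zero to [B] stays locally constant because
    [A] is open in [B]: this gives the map [k_A -> k_B]. *)
Lemma cst_sec_prop_ext A B U (s : T -> k) :
  A `<=` B -> (forall x, A x -> \forall y \near x, B y -> A y) ->
  cst_sec_prop A U s -> cst_sec_prop B U s.
Proof.
move=> AB oA sP; have [s1 s2 s3] := sP; split=> // x.
  by move=> nBU; apply: s1 => -[/AB Bx Ux]; exact: nBU.
move=> [Bx Ux]; have [Ax|nAx] := pselect (A x).
  have := s2 x (conj Ax Ux); have := oA x Ax.
  by apply: filterS2 => y BA sy /BA /sy.
have sx : s x = 0 by apply: s1 => -[].
by have := cst_sec_near0 sP Ux sx; apply: filterS => y sy _; rewrite sy sx.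
Qed.

Section Extension.
Context {A B : set T} (AB : A `<=` B).
Hypothesis oA : forall x, A x -> \forall y \near x, B y -> A y.

Lemma cst_ext_subproof U (s : cst_sec k A U) : \val s \in cst_sec_pred B U.
Proof.
by apply/asboolP; apply: cst_sec_prop_ext AB oA _; exact/asboolP/(valP s).
Qed.

Definition cst_ext U (s : cst_sec k A U) : cst_sec k B U :=
  CstSec (cst_ext_subproof U s).

Lemma cst_ext_linear U : linear (cst_ext U).
Proof. by move=> c s t; exact/val_inj. Qed.

HB.instance Definition _ U :=
  GRing.isLinear.Build k (cst_sec k A U) (cst_sec k B U) *:%R (cst_ext U)
    (cst_ext_linear U).

Lemma cst_ext_res U V (h : V `<=` U) (s : cst_sheaf k P A U) :
  (cst_ext V (res h s) : cst_sheaf k P B V) =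
  res h (cst_ext U s : cst_sheaf k P B U).
Proof. exact/val_inj. Qed.

Definition cst_ext_hom : sheaf_hom (cst_sheaf k P A) (cst_sheaf k P B) :=
  @SheafHom _ _ _ (cst_sheaf k P A) (cst_sheaf k P B) cst_ext cst_ext_res.

Lemma cst_ext_inj U : injective (cst_ext_hom U).
Proof. by move=> s t /(congr1 val) st; exact/val_inj. Qed.

End Extension.

Lemma cst_ind_subproof A U : U `&` closure A `<=` A ->
  (\1_(A `&` U) : T -> k^o) \in cst_sec_pred A U.
Proof.
move=> clA; apply/asboolP; split=> [x nx|x [Ax Ux]|x [Ux cl]].
- by rewrite indicE memNset.
- have : \forall y \near x, carrier U y.
    by apply: open_nbhs_nbhs; split=> //; exact: opens_open.
  by apply: filterS => y Uy Ay; rewrite !indicE !mem_set.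
- have Ax : A x.
    apply: clA; split=> // N /cl [y [/= + Ny]]; rewrite indicE.
    case: (boolP (y \in _)) => [/set_mem [Ay _] _|_]; last by rewrite eqxx.
    by exists y.
  by rewrite /= indicE mem_set ?oner_eq0.
Qed.

Definition cst_ind {A U} (h : U `&` closure A `<=` A) : cst_sheaf k P A U :=
  CstSec (cst_ind_subproof A U h).

Lemma cst_ind_in A U (h : U `&` closure A `<=` A) x :
  A x -> carrier U x -> cst_sec_val (cst_ind h) x = 1.
Proof. by move=> Ax Ux; rewrite /= indicE mem_set. Qed.

Lemma cst_ind_out A U (h : U `&` closure A `<=` A) x :
  ~ A x -> cst_sec_val (cst_ind h) x = 0.
Proof. by move=> nAx; rewrite /= indicE memNset// => -[]. Qed.

Lemma cst_resE A U V (h : V `<=` U) (s : cst_sheaf k P A U) x :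
  carrier V x -> cst_sec_val (res h s) x = cst_sec_val s x.
Proof. by move=> Vx; rewrite /= /cst_res_fun mem_set. Qed.

Lemma cst_sec_ext A U (s t : cst_sheaf k P A U) :
  (forall x, A x -> carrier U x -> cst_sec_val s x = cst_sec_val t x) -> s = t.
Proof.
move=> st; apply/val_inj/funext => x /=.
have [[Ax Ux]|nx] := pselect ((A `&` U) x).
  exact: st.
have /asboolP[s1 _ _] := valP s; have /asboolP[t1 _ _] := valP t.
by rewrite s1// t1.
Qed.

End ConstantSheafMaps.

Section ComposeHom.
Context {k : comNzRingType} {T : topologicalType} {P : set T}.
Context {F G H : sheaf k P} (g : sheaf_hom G H) (f : sheaf_hom F G).

Lemma comp_hom_res (U V : opens P) (h : V `<=` U) (s : F U) :
  (g V \o f V) (res h s) = res h ((g U \o f U) s).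
Proof. by rewrite /= !hom_res. Qed.

Definition comp_hom : sheaf_hom F H :=
  @SheafHom _ _ _ F H (fun U => [the {linear F U -> H U} of g U \o f U])
    comp_hom_res.

End ComposeHom.

(** * Nonvanishing of local cohomology *)

Section LocalCohomology.
Context {k : comNzRingType} {T : topologicalType} {P : set T}.
Variables (A : set T) (U : opens P) (Z : set T) (p : T).
Hypotheses (Up : carrier U p) (Ap : A p).
Let F : sheaf k P := cst_sheaf k P A.

(** In degree -1 the complex [F] is zero, so a quasi-isomorphism from [F]
    cannot send a nonzero section of [F] to a coboundary. *)
Lemma concentrated_exact (I : cochain k P) (q : cochain_hom (concentrated F) I)
    (W : opens P) (s : F W) (u : I (-1) W) :
  quasi_iso q -> q 0 W s = diffl I (-1) W u -> s = 0.
Proof.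
move=> [qi _] qs; apply: cst_sec_ext => x _ Wx.
have [V [h [v [Vx sV]]]] := qi (-1) W s u erefl qs x Wx.
have : (0 : F V) = res h s := sV.
move=> /(congr1 (fun s => cst_sec_val s x)).
by rewrite cst_resE// => <-.
Qed.

(** Every section of [k_A] is supported in [Z], hence the section 1 gives a
    class in degree 0, which is nonzero because its germ at [p] is. *)
Lemma RGamma_stalk_neq0_deg0 :
  U `&` closure A `<=` A -> A `&` U `<=` Z ->
  ~ RGamma_stalk_eq0 (concentrated F) U Z p.
Proof.
move=> clA AZ [I [q [[_ _ q_iso] exact_at]]].
pose e : F U := cst_ind clA.
have e_supp : @supported_in k T P (I 0) Z U (q 0 U e).
  move=> W h WZ; rewrite -(hom_res (q 0)) (_ : res h e = 0) ?raddf0//.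
  apply: cst_sec_ext => x Ax Wx.
  suff : (W `&` Z) x by rewrite WZ.
  by split=> //; apply: AZ; split=> //; exact: h.
have de0 : diffl I 0 U (q 0 U e) = 0.
  by rewrite -(@chom_diffl _ _ _ _ _ q 0) raddf0.
have [//|W [h [t [Wp _ dt]]]] := exact_at (-1) U (q 0 U e) _ Up e_supp de0.
have : res h e = 0.
  by apply: concentrated_exact q_iso _; rewrite (hom_res (q 0)) -dt.
move=> /(congr1 (fun s => cst_sec_val s p)).
by rewrite cst_resE// cst_ind_in//; exact/eqP/oner_neq0.
Qed.

(** The point [p] cuts [A] into [B] and the rest, and both pieces reach [p]
    outside of [Z]. The characteristic function of [B] is then a section of
    [k_A] away from [p] that does not extend across [p]; its image under the
    connecting map is a nonzero class of degree 1 supported in [Z]. *)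
Lemma RGamma_stalk_neq0_cut (B : set T) :
  B `<=` A -> ~ B p -> (forall x, B x -> \forall y \near x, A y -> B y) ->
  U `&` closure (p |` B) `<=` p |` B ->
  Z p -> open (U `\` Z) -> closure (B `\` Z) p -> closure ((A `\` B) `\` Z) p ->
  ~ RGamma_stalk_eq0 (concentrated F) U Z p.
Proof.
move=> BA nBp oB clB Zp oUZ nearB nearAB [I [q [[_ I_inj q_iso] exact_at]]].
have BB : B `<=` p |` B by move=> x Bx; right.
have oBB x : B x -> \forall y \near x, (p |` B) y -> B y.
  by move=> Bx; apply: filterS (oB x Bx) => y AB [yp|//]; apply: AB; rewrite yp.
(* [s] extends across [p] the image in [I^0] of the section 1 of [k_B], which
   is defined only away from [p]. *)
pose G := comp_hom (q 0 : sheaf_hom F (I 0)) (cst_ext_hom BA oB).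
have [g gE] := I_inj 0 _ _ (cst_ext_hom BB oBB) G (cst_ext_inj BB oBB).
pose s : I 0 U := g U (cst_ind clB).
have clBW (W : opens P) : W `<=` U -> ~ carrier W p -> W `&` closure B `<=` B.
  move=> WU nWp x [Wx clx].
  have [|xp|//] := clB x; first by split; [exact: WU|exact: closureS clx].
  by rewrite xp in Wx.
have sE (W : opens P) (h : W `<=` U) (nWp : ~ carrier W p) :
    res h s = q 0 W (cst_ext BA oB W (cst_ind (clBW W h nWp))).
  have -> : res h s = g W (res h (cst_ind clB)) by rewrite hom_res.
  suff -> : res h (cst_ind clB) =
      cst_ext_hom BB oBB W (cst_ind (clBW W h nWp))
      :> cst_sheaf k P (p |` B) W by rewrite gE.
  apply: cst_sec_ext => x [->//|Bx] Wx.
  by rewrite cst_resE// cst_ind_in//; [rewrite [RHS]cst_ind_in|right|exact: h].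
(* A region that avoids [Z] avoids [p], and there [s] comes from [F]. *)
have ds_supp : @supported_in k T P (I 1) Z U (diffl I 0 U s).
  move=> W h WZ.
  have nWp : ~ carrier W p by move=> Wp; have : (W `&` Z) p by []; rewrite WZ.
  rewrite -(hom_res (diffl I 0)) sE.
  by rewrite -(@chom_diffl _ _ _ _ _ q 0) raddf0.
have dds : diffl I 1 U (diffl I 0 U s) = 0 by exact: (@diffl2 _ _ _ I 0).
have [W [h [t [Wp t_supp dt]]]] :=
  exact_at 0 U (diffl I 0 U s) (fun _ => id) Up ds_supp dds.
have dst : diffl I 0 W (res h s - t) = 0.
  by rewrite raddfB /= hom_res dt subrr.
have [_ qs] := q_iso.
(* Up to a coboundary, [s - t] comes from a section of [F] around [p]. *)
have [V [hV [s' [u [Vp _ stE]]]]] := qs (-1) W (res h s - t) dst p Wp.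
(* Away from [Z] the section [t] vanishes, which identifies [s'] with the
   section 1 of [k_B]. *)
have oN : open (V `&` (U `\` Z)) by apply: openI => //; exact: opens_open.
have VU : V `<=` U by move=> x /hV /h.
have sN : V `&` (U `\` Z) `<=` P by move=> x [/opens_sub].
pose N := Opens oN sN.
have NV : N `<=` V by move=> x [].
have NU : N `<=` U by move=> x [_ []].
have NW : N `<=` W by move=> x /NV /hV.
have nNp : ~ carrier N p by move=> [_ []].
have s'E : cst_ext BA oB N (cst_ind (clBW N NU nNp)) - res NV s' = 0 :> F N.
  apply: (@concentrated_exact I q N _ (res NV u) q_iso).
  rewrite raddfB /= -sE.
  have tN : res NW t = 0.
    by apply: t_supp; rewrite -subset0 => x [[_ [_ nZx]]].
  have := congr1 (res NV) stE.
  rewrite (res_comp hV NV NW) raddfB /= tN subr0 (res_comp h NW NU) => ->.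
  by rewrite raddfD /= !hom_res addrAC subrr add0r.
have s'B x : carrier N x -> A x -> cst_sec_val s' x = (x \in B)%:R.
  move=> Nx Ax; have /(congr1 (fun s => cst_sec_val s x)) := subr0_eq s'E.
  rewrite cst_resE// => <-; have [Bx|nBx] := pselect (B x).
    by rewrite [LHS]cst_ind_in// mem_set.
  by rewrite [LHS]cst_ind_out// memNset.
(* But [s'] is constant on [A] near [p], whereas both pieces accumulate
   there. *)
have /asboolP[_ s'_cst _] := cst_sec_valP s'.
have near_p : \forall y \near p,
    carrier V y /\ (A y -> cst_sec_val s' y = cst_sec_val s' p).
  have := s'_cst p (conj Ap Vp); have : \forall y \near p, carrier V y.
    by apply: open_nbhs_nbhs; split=> //; exact: opens_open.
  exact: filterS2.
have [x [[Bx nZx] [Vx /(_ (BA _ Bx)) s'x]]] := nearB _ near_p.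
have [y [[[Ay nBy] nZy] [Vy /(_ Ay) s'y]]] := nearAB _ near_p.
have VN z : carrier V z -> ~ Z z -> carrier N z.
  by move=> Vz nZz; split=> //; split=> //; exact: VU.
move: s'x; rewrite -s'y !s'B//; [|exact: VN|exact: VN|exact: (BA _ Bx)].
by rewrite mem_set// memNset//; exact/eqP/oner_neq0.
Qed.

End LocalCohomology.

(** * Smoothness of the test functions *)

Section Quadratic.
Context {R : realType}.
Implicit Types (z v : R * R) (U : set (R * R)).

(** This family contains both test functions and is stable under directional
    derivatives. *)
Definition quad (A B C D : R) z : R := A * z.1 ^+ 2 + B * z.1 + C * z.2 + D.

Lemma is_diff_fst z : is_diff z (@fst R R) (@fst R R).
Proof.
by apply: DiffDef; [apply: linear_differentiable|rewrite diff_lin] => // w;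
  exact: cvg_fst.
Qed.

Lemma is_diff_snd z : is_diff z (@snd R R) (@snd R R).
Proof.
by apply: DiffDef; [apply: linear_differentiable|rewrite diff_lin] => // w;
  exact: cvg_snd.
Qed.

Lemma is_diff_quad A B C D z :
  is_diff z (quad A B C D) (fun v => (2 * A * z.1 + B) * v.1 + C * v.2).
Proof.
have d1 := is_diff_fst z; have d2 := is_diff_snd z.
rewrite (_ : quad A B C D = A *: (fst : R * R -> R) ^+ 2
  + B *: (fst : R * R -> R) + C *: (snd : R * R -> R) + cst D)//.
apply: is_diff_eq; apply/funext => v.
rewrite !fctE /= /GRing.scale /= expr1.
by rewrite [X in _ + X = _](_ : _ = 0)//; ring.
Qed.

Lemma iter_derive_quad vs A B C D : exists A' B' C' D',
  iter_derive vs (quad A B C D) = quad A' B' C' D'.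
Proof.
elim: vs => [|v vs [A' [B' [C' [D' IH]]]]]; first by exists A, B, C, D.
exists 0, (2 * A' * v.1), 0, (B' * v.1 + C' * v.2).
rewrite /= IH; apply/funext => z.
have dq := is_diff_quad A' B' C' D' z.
rewrite deriveE; last exact: ex_diff.
by rewrite diff_val /quad; ring.
Qed.

Lemma smooth_on_quad U A B C D : smooth_on U (quad A B C D).
Proof.
move=> vs z _; have [A' [B' [C' [D' ->]]]] := iter_derive_quad vs A B C D.
by have dq := is_diff_quad A' B' C' D' z; exact: ex_diff.
Qed.

Lemma continuous_quad A B C D : continuous (quad A B C D).
Proof.
move=> z; apply: differentiable_continuous.
by have dq := is_diff_quad A B C D z; exact: ex_diff.
Qed.

End Quadratic.

(** * The graph of a continuous function *)

Section GraphTopology.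
Context {R : realType} {a b : R} {f : R -> R}.
Hypothesis cf : {in `]a, b[, continuous f}.

Lemma open_strip : open (strip a b).
Proof.
rewrite (_ : strip a b = fst @^-1` `]a, b[%classic).
  by apply: open_comp => // z _; exact: cvg_fst.
by apply/seteqP; split=> z //= [].
Qed.

Lemma open_graph_closed :
  strip a b `&` closure (open_graph a b f) `<=` open_graph a b f.
Proof.
move=> z [[/= abz _] clz]; split; first by rewrite in_itv in abz.
apply/eqP; rewrite -subr_eq0; apply/negPn/negP => nz.
have : (fun w => w.2 - f w.1) w @[w --> z] --> z.2 - f z.1.
  apply: cvgB; first exact: cvg_snd.
  by apply: (@cvg_comp _ _ _ fst f _ (nbhs z.1)); [exact: cvg_fst|exact: cf].
move=> /cvgr_neq0 /(_ nz) /clz [w [[_ ->]]].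
by rewrite /= subrr eqxx.
Qed.

Lemma graph_cvg c : c \in `]a, b[ ->
  (fun x => (x, f x)) @ c --> ((c, f c) : R * R).
Proof.
move=> cab; apply: (@cvg_pair _ _ _ _ (nbhs c) (nbhs (f c))); last exact: cf.
exact: cvg_id.
Qed.

Lemma near_graph_right c (N : set (R * R)) : c \in `]a, b[ -> nbhs (c, f c) N ->
  exists x, [/\ c < x, a < x < b & N (x, f x)].
Proof.
move=> cab Np.
have [ac cb] : a < c /\ c < b by apply/andP; move: cab; rewrite in_itv.
have Nr : \forall x \near c^'+, N (x, f x).
  exact: (cvg_at_right_filter (graph_cvg c cab)).
have : \forall x \near c^'+, [/\ c < x, a < x < b & N (x, f x)].
  near=> x; have cx : c < x by near: x; exact: (nbhs_right_gt c).
  split=> //; last by near: x; exact: Nr.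
  by rewrite (lt_trans ac cx)/=; near: x; exact: nbhs_right_lt.
exact: filter_ex.
Unshelve. all: by end_near. Qed.

Lemma near_graph_left c (N : set (R * R)) : c \in `]a, b[ -> nbhs (c, f c) N ->
  exists x, [/\ x < c, a < x < b & N (x, f x)].
Proof.
move=> cab Np.
have [ac cb] : a < c /\ c < b by apply/andP; move: cab; rewrite in_itv.
have Nr : \forall x \near c^'-, N (x, f x).
  exact: (cvg_at_left_filter (graph_cvg c cab)).
have : \forall x \near c^'-, [/\ x < c, a < x < b & N (x, f x)].
  near=> x; have xc : x < c by near: x; exact: (nbhs_left_lt c).
  split=> //; last by near: x; exact: Nr.
  by rewrite (lt_trans xc cb) andbT; near: x; exact: nbhs_left_gt.
exact: filter_ex.
Unshelve. all: by end_near. Qed.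

End GraphTopology.

(** * Vertical covectors at an extremum *)

Section Conormal.
Context {R : realType} {k : comNzRingType} {a b : R} {f : R -> R}.
Hypothesis cf : {in `]a, b[, continuous f}.
Context {c tau : R} (cab : c \in `]a, b[).
Let P := strip a b.
Let F := concentrated (cst_sheaf k P (open_graph a b f)).
Let p := (c, f c).
Let U : opens P := Opens open_strip (@subset_refl _ P).

Let Up : carrier U p.
Proof. by split. Qed.

Let Ap : open_graph a b f p.
Proof. by split=> //; move: cab; rewrite in_itv. Qed.

Lemma not_Ppg_graph_ge0 : (forall x, a < x < b -> 0 <= tau * (f x - f c)) ->
  ~ Ppg F (p, (0, tau)).
Proof.
move=> tau_ge0; pose phi := quad 0 0 tau (- tau * f c).
have phi_p : phi p = 0 by rewrite /phi /quad /=; ring.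
have dphi v : 'd phi p v = 0 * v.1 + tau * v.2.
  have dq := is_diff_quad 0 0 tau (- tau * f c) p.
  by rewrite diff_val /=; ring.
move=> [_ /(_ U phi Up (smooth_on_quad _ _ _ _ _) phi_p dphi)].
apply: RGamma_stalk_neq0_deg0 => //; first exact: open_graph_closed.
move=> z [[zab z2] Uz]; split=> //=.
by have := tau_ge0 _ zab; rewrite /phi /quad -z2; lra.
Qed.

(** The quadratic term of [phi] is invisible in the differential at [p] but
    makes [phi] negative on the rest of the graph, so that [p] cuts it. *)
Lemma not_Ppg_graph_le0 : (forall x, a < x < b -> tau * (f x - f c) <= 0) ->
  ~ Ppg F (p, (0, tau)).
Proof.
move=> tau_le0; 
(* [phi = tau * (y - f c) - (x - c)^2] *)
pose phi := quad (- 1) (2 * c) tau (- c ^+ 2 - tau * f c).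
have phi_lt0 z : open_graph a b f z -> z.1 != c -> phi z < 0.
  move=> [zab z2] zc.
  have sq : 0 < (z.1 - c) ^+ 2 by rewrite exprn_even_gt0// subr_eq0.
  by have := tau_le0 _ zab; rewrite /phi /quad -z2; nra.
have phi_p : phi p = 0 by rewrite /phi /quad /=; ring.
have dphi v : 'd phi p v = 0 * v.1 + tau * v.2.
  have dq := is_diff_quad (- 1) (2 * c) tau (- c ^+ 2 - tau * f c) p.
  by rewrite diff_val /=; ring.
move=> [_ /(_ U phi Up (smooth_on_quad _ _ _ _ _) phi_p dphi)].
pose B := open_graph a b f `&` [set z | c < z.1].
apply: (@RGamma_stalk_neq0_cut _ _ _ _ _ _ _ _ _ B) => //.
- exact: subIsetl.
- by move=> [_]; rewrite /= ltxx.
- move=> x [_ /= cx].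
  have oc : open [set w : R * R | c < w.1].
    by apply: open_comp (@open_gt _ c) => w _; exact: cvg_fst.
  by apply: filterS (open_nbhs_nbhs (conj oc cx)).
- move=> z [Uz clz].
  have cz : closed [set w : R * R | c <= w.1].
    by apply: preimage_closed (@closed_ge _ c) => w _; exact: cvg_fst.
  have /cz /= : closure [set w : R * R | c <= w.1] z.
    by apply: closureS clz => w [->|[_ /ltW]] /=.
  have Gz : open_graph a b f z.
    apply: (open_graph_closed cf); split=> //.
    by apply: closureS clz => w [->|[]].
  rewrite le_eqVlt => /predU1P[cz1|]; last by right.
  by left; move: Gz => [_]; rewrite /p; case: (z) cz1 => ? ? /= <- ->.
- by split; rewrite //= phi_p.
- rewrite setDIr setDv set0U setDE; apply: openI; first exact: open_strip.
  rewrite (_ : ~` _ = phi @^-1` [set r | r < 0]).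
    by apply: open_comp (@open_lt _ 0) => w _; exact: continuous_quad.
  by apply/seteqP; split=> w /=; rewrite ltNge => /negP.
- move=> N /(near_graph_right cf _ _ cab) [x [cx xab Nx]].
  exists (x, f x); split=> //; split=> [|[_]]; first by split.
  by rewrite /= leNgt phi_lt0// gt_eqF.
- move=> N /(near_graph_left cf _ _ cab) [x [xc xab Nx]].
  exists (x, f x); split=> //; split=> [|[_]].
    by split=> // -[_] /=; rewrite ltNge (ltW xc).
  by rewrite /= leNgt phi_lt0// lt_eqF.
Qed.

End Conormal.

(** If the maximum and the minimum were both reached at the end points only,
    they would be equal and [f] constant. *)
Lemma interior_extremum {R : realType} {a b : R} {f : R -> R} :
  a < b -> {within `[a, b], continuous f} -> f a = f b ->
  exists2 c, c \in `]a, b[%R &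
    (forall x, a < x < b -> f x <= f c) \/ (forall x, a < x < b -> f c <= f x).
Proof.
move=> ab cf fab.
have oc x : a < x < b -> x \in `[a, b]%R.
  by move=> /andP[/ltW ax /ltW xb]; rewrite in_itv /= ax.
have itvE x : x \in `[a, b]%R -> x \in `]a, b[%R \/ f x = f a.
  rewrite !in_itv /= => /andP[]; rewrite !le_eqVlt.
  by move=> /predU1P[->|->] /predU1P[->|->]; [right|right|right|left].
have [M Mab fM] := EVT_max (ltW ab) cf.
have [m mab fm] := EVT_min (ltW ab) cf.
have [Mi|fMa] := itvE M Mab; first by exists M => //; left=> x /oc /fM.
have [mi|fma] := itvE m mab; first by exists m => //; right=> x /oc /fm.
have mid : a < (a + b) / 2 < b by apply/andP; split; lra.
exists ((a + b) / 2); first by rewrite in_itv.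
by left=> x /oc /fM; rewrite fMa -fma => /le_trans; apply; apply: fm; exact: oc.
Qed.

Theorem lemma6p1 (k : comNzRingType) (hk : finite_global_dimension k)
    (R : realType) (a b : R) (hab : a < b) (f : R -> R)
    (hf : {within `[a, b], continuous f}) (hfab : f a = f b) :
  exists c : R, (a < c < b) /\ [set 0] `*` [set: R] `<=` Lambda k a b f c.
Proof.
have [c cab ext] := interior_extremum hab hf hfab.
have [cf _ _] := (continuous_within_itvP f hab).1 hf.
exists c; split; first by move: cab; rewrite in_itv.
move=> [_ tau] [/= -> _]; split; first by split.
apply: subset_closure; split; first by split.
have [tau_ge0|/ltW tau_le0] := leP 0 tau; case: ext => ext.
- apply: not_Ppg_graph_le0 => // x /ext; rewrite -subr_le0.
  exact: mulr_ge0_le0.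
- apply: not_Ppg_graph_ge0 => // x /ext; rewrite -subr_ge0.
  exact: mulr_ge0.
- apply: not_Ppg_graph_ge0 => // x /ext; rewrite -subr_le0.
  exact: mulr_le0.
- apply: not_Ppg_graph_le0 => // x /ext; rewrite -subr_ge0.
  exact: mulr_le0_ge0.
Qed.
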